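(* Let $Q$ be a digraph, let $Q'$ be a symmetric digraph, and let $\phi: N_{\mathbf{Digra}}(Q')\to Q$ be a morphism in $\mathbf{Digra}$. Then there is a unique morphism $\hat{\phi}: Q'\to N^{\star}_{\mathbf{Digra}}(Q)$ in $\mathbf{SDigra}$ such that $\nu_{Q}\circ N_{\mathbf{Digra}}(\hat{\phi})=\phi$.
   Context: A digraph is a pair $Q=(\vec V(Q),\vec E(Q))$ with $\vec V(Q)$ a set and $\vec E(Q)\subseteq\vec V(Q)\times\vec V(Q)$. The category $\mathbf{Digra}$ has digraphs as objects; a morphism $f:Q\to Q'$ is a function $f:\vec V(Q)\to\vec V(Q')$ such that $(v,w)\in\vec E(Q)$ implies $(f(v),f(w))\in\vec E(Q')$. A digraph is symmetric if $(v,w)\in\vec E(Q)$ implies $(w,v)\in\vec E(Q)$. $\mathbf{SDigra}$ is the full subcategory of $\mathbf{Digra}$ consisting of all symmetric digraphs, and $N_{\mathbf{Digra}}:\mathbf{SDigra}\to\mathbf{Digra}$ is the inclusion functor. Symmetric interior: for a digraph $Q$, $N^{\star}_{\mathbf{Digra}}(Q)$ is the symmetric digraph with vertex set $\vec V(Q)$ and edge set $\{(v,w):(v,w)\in\vec E(Q)\text{ and }(w,v)\in\vec E(Q)\}$. The morphism $\nu_Q:N_{\mathbf{Digra}}N^{\star}_{\mathbf{Digra}}(Q)\to Q$ in $\mathbf{Digra}$ is the canonical inclusion, i.e. the identity function on vertices. *)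

(* Defs.v *)
From Stdlib Require Import Relation_Definitions.
Set Implicit Arguments.
Unset Strict Implicit.
Unset Printing Implicit Defensive.

Record category := Category {
  obj : Type;
  hom : obj -> obj -> Type;
  idm : forall a, hom a a;
  comp : forall a b c, hom b c -> hom a b -> hom a c;
  comp_idl : forall a b (f : hom a b), comp (idm b) f = f;
  comp_idr : forall a b (f : hom a b), comp f (idm a) = f;
  comp_assoc : forall a b c d (h : hom c d) (g : hom b c) (f : hom a b),
    comp h (comp g f) = comp (comp h g) f
}.

Record functor (C D : category) := Functor {
  fobj : obj C -> obj D;
  fmap : forall a b : obj C, hom a b -> hom (fobj a) (fobj b);
  fmap_id : forall a : obj C, fmap (idm a) = idm (fobj a);
  fmap_comp : forall (a b c : obj C) (g : hom b c) (f : hom a b),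
    fmap (comp g f) = comp (fmap g) (fmap f)
}.

Definition full_subcategory (C : category) (P : obj C -> Prop) : category := {|
  obj := {a : obj C | P a};
  hom := fun a b => hom (proj1_sig a) (proj1_sig b);
  idm := fun a => idm (proj1_sig a);
  comp := fun _ _ _ g f => comp g f;
  comp_idl := fun _ _ f => comp_idl f;
  comp_idr := fun _ _ f => comp_idr f;
  comp_assoc := fun _ _ _ _ h g f => comp_assoc h g f
|}.

Definition inclusion_functor (C : category) (P : obj C -> Prop) :
    functor (full_subcategory P) C :=
  @Functor (full_subcategory P) C (fun a => proj1_sig a) (fun _ _ f => f)
    (fun _ => eq_refl) (fun _ _ _ _ _ => eq_refl).

Record digraph := Digraph {
  vertex : Type;
  edge : relation vertex
}.

Record digraph_hom (Q Q' : digraph) := DigraphHom {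
  vmap : vertex Q -> vertex Q';
  vmap_edge : forall v w, edge v w -> edge (vmap v) (vmap w)
}.

Definition digraph_id (Q : digraph) : digraph_hom Q Q :=
  @DigraphHom Q Q (fun v => v) (fun _ _ e => e).

Definition digraph_comp (Q1 Q2 Q3 : digraph)
    (g : digraph_hom Q2 Q3) (f : digraph_hom Q1 Q2) : digraph_hom Q1 Q3 :=
  @DigraphHom Q1 Q3 (fun v => vmap g (vmap f v))
    (fun _ _ e => vmap_edge g (vmap_edge f e)).

Definition Digra : category.
Proof.
refine {| obj := digraph; hom := digraph_hom;
          idm := digraph_id; comp := digraph_comp |}.
- now intros Q Q' [f ef].
- now intros Q Q' [f ef].
- reflexivity.
Defined.

Definition is_symmetric (Q : obj Digra) : Prop := symmetric (vertex Q) (@edge Q).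

Definition SDigra : category := full_subcategory is_symmetric.

Definition N_Digra : functor SDigra Digra := inclusion_functor is_symmetric.

Definition interior (Q : digraph) : digraph :=
  {| vertex := vertex Q; edge := fun v w => edge v w /\ edge w v |}.

Lemma interior_symmetric (Q : digraph) : is_symmetric (interior Q).
Proof. intros v w [e1 e2]; split; assumption. Qed.

Definition Nstar_Digra (Q : obj Digra) : obj SDigra :=
  exist is_symmetric (interior Q) (@interior_symmetric Q).

Definition nu (Q : obj Digra) : hom (fobj N_Digra (Nstar_Digra Q)) Q :=
  @DigraphHom (interior Q) Q (fun v => v) (fun v w e => proj1 e).

(* Main.v *)
Require Import Defs.
From Stdlib Require Import ProofIrrelevance.

(** Since [nu Q] is the identity on vertices, any factorisation of [phi] through it has the vertex
    map of [phi], and by [digraph_hom_eq] this determines it. The same map does land in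
    [interior Q]: each edge of the symmetric [Q'] can be reversed before [phi] is applied. *)

Lemma digraph_hom_eq (Q Q' : digraph) (f g : digraph_hom Q Q') :
  vmap f = vmap g -> f = g.
Proof.
destruct f as [f ef], g as [g eg]; simpl; intros <-.
now rewrite (proof_irrelevance _ ef eg).
Qed.

Definition interior_lift {Q Q' : digraph} (Q'sym : is_symmetric Q')
    (phi : digraph_hom Q' Q) : digraph_hom Q' (interior Q) :=
  @DigraphHom Q' (interior Q) (vmap phi)
    (fun v w e => conj (vmap_edge phi e) (vmap_edge phi (Q'sym v w e))).

Theorem theorem2p8 (Q : obj Digra) (Q' : obj SDigra)
    (phi : hom (fobj N_Digra Q') Q) :
  exists! phihat : hom Q' (Nstar_Digra Q),
    comp (nu Q) (fmap N_Digra phihat) = phi.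
Proof.
exists (interior_lift (proj2_sig Q') phi); split.
- now apply digraph_hom_eq.
(* With [phi] replaced by [comp (nu Q) psi], the vertex map of the lift is convertible to that of
   [psi]. *)
- intros psi <-.
  now apply digraph_hom_eq.
Qed.
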